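(* Let $D$ be a domain each of whose ideals can be generated by two elements. Then $D$ is a $\star$-domain if and only if $D$ is a Dedekind domain.
   Context: A domain $D$ is called a $\star$-domain if $a^2D\cap b^2D=(aD\cap bD)^2$ for every $a,b\in D$. Fields are regarded as (trivial) Dedekind domains. *)

(* Defs.v *)
From HB Require Import structures.
From mathcomp Require Import all_boot all_order all_algebra.
From mathcomp Require Import classical_sets.

Set Implicit Arguments.
Unset Strict Implicit.
Unset Printing Implicit Defensive.

Import GRing.Theory.
Local Open Scope classical_set_scope.
Local Open Scope ring_scope.

(* Ideals are arbitrary (Prop-valued) subsets: the [idealr] structures of
   [ring_quotient] only cover proper ideals with decidable membership. *)
Definition is_ideal (D : idomainType) (I : set D) : Prop :=
  [/\ I 0,
      forall x y, I x -> I y -> I (x + y)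
    & forall a x, I x -> I (a * x)].

Definition ideal_gen (D : idomainType) (S : set D) : set D :=
  smallest (@is_ideal D) S.

Definition principal (D : idomainType) (a : D) : set D :=
  [set a * d | d in [set: D]].

Definition ideal_mul (D : idomainType) (I J : set D) : set D :=
  ideal_gen [set x * y | x in I & y in J].

Definition star_domain (D : idomainType) : Prop :=
  forall a b : D,
    principal (a ^+ 2) `&` principal (b ^+ 2) =
    ideal_mul (principal a `&` principal b) (principal a `&` principal b).

(* [a] and [b] may coincide, so principal ideals are allowed. *)
Definition ideals_two_generated (D : idomainType) : Prop :=
  forall I : set D, is_ideal I -> exists a b : D, I = ideal_gen [set a; b].

Definition noetherian (D : idomainType) : Prop :=
  forall I : set D, is_ideal I -> exists s : seq D, I = ideal_gen [set` s].

Definition prime_ideal (D : idomainType) (P : set D) : Prop :=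
  [/\ is_ideal P, P <> [set: D] & forall x y, P (x * y) -> P x \/ P y].

Definition maximal_ideal (D : idomainType) (M : set D) : Prop :=
  [/\ is_ideal M, M <> [set: D]
    & forall J, is_ideal J -> M `<=` J -> J = M \/ J = [set: D]].

Definition integrally_closed (D : idomainType) : Prop :=
  forall z : {fraction D},
    integralOver (@tofrac D) z -> exists d : D, z = tofrac d.

(* Fields are included: no condition forces a nonzero prime to exist. *)
Definition dedekind_domain (D : idomainType) : Prop :=
  [/\ noetherian D, integrally_closed D
    & forall P : set D, prime_ideal P -> P <> [set 0] -> maximal_ideal P].

(* Main.v *)
(** Let [I = (a, b)].  Since [I^2 = (a^2, ab, b^2)] is generated by two
elements, the three generators satisfy relations whose coefficients generate
the unit ideal; when [D] contains the roots in its fraction field of monic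
quadratic polynomials, such relations make [I] invertible.  On the other hand
the star property forces this closure: for [z] a quadratic integer, the
conductor [C = (D : D[z])] satisfies [C = C^2], so [C = D] by Nakayama.  As all
ideals have two generators, a finite integral extension inside the fraction
field only contains roots of monic quadratics, so that quadratic closure is
integral closure.  Invertibility of [(a, b)] yields both the star property, by
expanding [1 = (x + y)^3], and the maximality of nonzero primes. *)

Require Import Defs.
From mathcomp Require Import all_boot all_order all_algebra.
From mathcomp Require Import boolp classical_sets generic_quotient ring.

Set Implicit Arguments.
Unset Strict Implicit.
Unset Printing Implicit Defensive.

Import GRing.Theory Pdiv.RingMonic Pdiv.CommonRing.
Local Open Scope classical_set_scope.
Local Open Scope ring_scope.

(* The condition [n^2 = x n m + y m^2] says that [n / m] is a root of
   ['X^2 - x 'X - y]. *)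
Definition quadratically_closed (D : idomainType) : Prop :=
  forall x y n m : D, m != 0 -> n ^+ 2 = x * n * m + y * m ^+ 2 ->
  exists s, n = m * s.

(* For nonzero [a] and [b] this is the invertibility of the ideal [(a, b)]. *)
Definition pairs_invertible (D : idomainType) : Prop :=
  forall a b : D, exists x y s t : D,
    [/\ x + y = 1, x * a = b * s & y * b = a * t].

(** * Fractions and monic quadratic polynomials *)

Lemma frac_quotient (D : idomainType) (z : {fraction D}) :
  exists n m : D, m != 0 /\ z = tofrac n / tofrac m.
Proof.
elim/quotW: z => -[[n m] /= m_neq0]; exists n, m; split=> //.
apply: (canRL (mulfK _)); first by rewrite tofrac_eq0.
unlock FracField.tofrac; rewrite -[LHS]FracField.pi_mul.
apply/eqmodP; rewrite /= FracField.equivfE /FracField.mulf /=.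
by rewrite !numden_Ratio ?mulr1 ?oner_neq0 // mulrC.
Qed.

Lemma integrally_quadratically_closed (D : idomainType) :
  integrally_closed D -> quadratically_closed D.
Proof.
move=> iclosed x y n m m_neq0 Enm.
have Fm_neq0 : tofrac m != 0 by rewrite tofrac_eq0.
have [|s Es] := iclosed (tofrac n / tofrac m).
  exists ('X^2 - (x *: 'X + y%:P)).
    rewrite monicE lead_coefDl ?lead_coefXn // size_polyN size_polyXn ltnS.
    rewrite (leq_trans (size_polyD _ _)) // geq_max.
    by rewrite (leq_trans (size_scale_leq _ _)) ?size_polyX //
      (leq_trans (size_polyC_leq1 _)).
  apply/rootP; rewrite rmorphB rmorphD /= map_polyXn map_polyZ map_polyX.
  rewrite map_polyC !hornerE /=.
  have /(congr1 (@tofrac D)) := Enm.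
  rewrite !(tofracXn, tofracD, tofracM) => EF.
  apply: (mulIf (expf_neq0 2 Fm_neq0)); rewrite mul0r.
  transitivity (tofrac n ^+ 2 -
    (tofrac x * tofrac n * tofrac m + tofrac y * tofrac m ^+ 2)).
    by field.
  by rewrite EF subrr.
exists s; apply/eqP; rewrite -tofrac_eq tofracM -Es.
by rewrite mulrCA divff ?mulr1.
Qed.

(** * Generators, products and intersections of ideals *)

Section Ideals.
Variable D : idomainType.
Implicit Types (a b c d : D) (I J : set D).

Lemma ideal_gen_ideal (S : set D) : is_ideal (ideal_gen S).
Proof.
split=> [A [[]] // | x y Ax Ay A AP | a x Ax A AP].
  by case: (AP) => -[_ + _] _; apply; [apply: Ax | apply: Ay].
by case: (AP) => -[_ _ +] _; apply; apply: Ax.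
Qed.

Lemma ideal_gen2P a b x :
  ideal_gen [set a; b] x <-> exists u v, x = u * a + v * b.
Proof.
split; last first.
  move=> [u [v ->]]; have [_ addI mulI] := ideal_gen_ideal [set a; b].
  apply: addI; apply: mulI; apply: sub_gen_smallest; first by left.
  by right.
apply: (smallest_sub (X := [set x | exists u v, x = u * a + v * b])).
  split=> /= [|x1 x2 [u [v ->]] [u' [v' ->]]|c x1 [u [v ->]]].
  - by exists 0, 0; ring.
  - by exists (u + u'), (v + v'); ring.
  - by exists (c * u), (c * v); ring.
move=> _ [->|->] /=; first by exists 1, 0; ring.
by exists 0, 1; ring.
Qed.

Lemma ideal_mul_in I J x y : I x -> J y -> ideal_mul I J (x * y).
Proof. by move=> Ix Jy; apply: sub_gen_smallest; exists x => //; exists y. Qed.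

Lemma ideal_mul_gen2P J c d x : is_ideal J ->
  ideal_mul J (ideal_gen [set c; d]) x ->
  exists j k, [/\ J j, J k & x = j * c + k * d].
Proof.
move=> [J0 addJ mulJ].
apply: (smallest_sub (X := [set x | exists j k,
  [/\ J j, J k & x = j * c + k * d]])).
  split=> /= [|x1 x2 [j [k [Jj Jk ->]]] [j' [k' [Jj' Jk' ->]]]
             |e x1 [j [k [Jj Jk ->]]]].
  - by exists 0, 0; split=> //; ring.
  - by exists (j + j'), (k + k'); split; [exact: addJ|exact: addJ|ring].
  - by exists (e * j), (e * k); split; [exact: mulJ|exact: mulJ|ring].
move=> _ [j Jj [y /ideal_gen2P [u [v ->]] <-]] /=.
exists (u * j), (v * j); split; [exact: mulJ|exact: mulJ|ring].
Qed.

Lemma principal_ideal a : is_ideal (principal a).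
Proof.
split=> [|_ _ [u _ <-] [v _ <-]|c _ [u _ <-]].
- by exists 0 => //; ring.
- by exists (u + v) => //; ring.
- by exists (c * u) => //; ring.
Qed.

Lemma setI_ideal I J : is_ideal I -> is_ideal J -> is_ideal (I `&` J).
Proof.
move=> [I0 addI mulI] [J0 addJ mulJ]; split=> //.
  by move=> x y [Ix Jx] [Iy Jy]; split; [exact: addI|exact: addJ].
by move=> a x [Ix Jx]; split; [exact: mulI|exact: mulJ].
Qed.

Lemma ideal_one I : is_ideal I -> I 1 -> I = [set: D].
Proof.
move=> [_ _ mulI] I1; apply/seteqP; split=> // x _.
by rewrite -[x]mulr1; exact: mulI.
Qed.

(** * Determinant tricks for ideals with two generators *)

Hypothesis two_gen : ideals_two_generated D.

Lemma nakayama I J x : is_ideal I -> is_ideal J -> I x -> x != 0 ->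
  I `<=` ideal_mul J I -> J 1.
Proof.
move=> /two_gen [c [d ->]] Jid /ideal_gen2P [u [v ->]] x_neq0 subI.
have [_ addJ mulJ] := Jid.
have [|j1 [j2 [J1 J2 Ec]]] := ideal_mul_gen2P Jid (subI c _).
  by apply/ideal_gen2P; exists 1, 0; ring.
have [|j3 [j4 [J3 J4 Ed]]] := ideal_mul_gen2P Jid (subI d _).
  by apply/ideal_gen2P; exists 0, 1; ring.
(* [e] is the determinant of [1 - A], where [A] has entries in [J] and fixes the column [(c, d)].
   The adjugate shows that [e] kills [c] and [d], hence [x]; so [e = 0], and expanding it puts 1 in
   [J]. *)
pose e := (1 - j1) * (1 - j4) - j2 * j3.
have ec : e * c = 0.
  transitivity ((1 - j4) * (c - (j1 * c + j2 * d)) +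
                j2 * (d - (j3 * c + j4 * d))); first by rewrite /e; ring.
  by rewrite -Ec -Ed; ring.
have ed : e * d = 0.
  transitivity (j3 * (c - (j1 * c + j2 * d)) +
                (1 - j1) * (d - (j3 * c + j4 * d))); first by rewrite /e; ring.
  by rewrite -Ec -Ed; ring.
have /eqP : e * (u * c + v * d) = 0.
  transitivity (u * (e * c) + v * (e * d)); first by ring.
  by rewrite ec ed; ring.
rewrite mulf_eq0 (negPf x_neq0) orbF => /eqP e0.
have -> : 1 = 1 * j1 + ((1 - j1) * j4 + j3 * j2).
  by apply/eqP; rewrite -subr_eq0 -e0 /e; apply/eqP; ring.
by apply: (addJ); [|apply: (addJ)]; apply: mulJ.
Qed.

(** Cayley-Hamilton: [n] acts on two generators of [I] as [m] times a 2 by 2 matrix [A]. The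
    determinant of [n - m A] kills [x], so it vanishes; [p] is the trace of [A] and [- q] its
    determinant. *)
Lemma stabilizer_quadratic I x n m : is_ideal I -> I x -> x != 0 ->
  (forall y, I y -> exists2 y', I y' & n * y = m * y') ->
  exists p q, n ^+ 2 = p * n * m + q * m ^+ 2.
Proof.
move=> /two_gen [c [d ->]] /ideal_gen2P [u [v ->]] x_neq0 stabI.
have [|_ /ideal_gen2P [a11 [a12 ->]] Ec] := stabI c.
  by apply/ideal_gen2P; exists 1, 0; ring.
have [|_ /ideal_gen2P [a21 [a22 ->]] Ed] := stabI d.
  by apply/ideal_gen2P; exists 0, 1; ring.
pose e := (n - m * a11) * (n - m * a22) - m ^+ 2 * (a12 * a21).
have /eqP : e * (u * c + v * d) = 0.
  transitivity
    ((u * (n - m * a22) + v * (m * a21)) * (n * c - m * (a11 * c + a12 * d)) +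
     (u * (m * a12) + v * (n - m * a11)) * (n * d - m * (a21 * c + a22 * d))).
    by rewrite /e; ring.
  by rewrite Ec Ed; ring.
rewrite mulf_eq0 (negPf x_neq0) orbF => /eqP e0.
exists (a11 + a22), (a12 * a21 - a11 * a22).
by apply/eqP; rewrite -subr_eq0 -e0 /e; apply/eqP; ring.
Qed.

(** * Quadratic closure, integral closure and invertibility *)

Lemma star_quadratically_closed : star_domain D -> quadratically_closed D.
Proof.
move=> star x y n m m_neq0 Enm.
have [n0|n_neq0] := eqVneq n 0; first by exists 0; rewrite n0 mulr0.
(* The conductor of [D] in [D[n / m] = D + D (n / m)]. *)
pose C : set D := [set e | exists k, e * n = m * k].
have Cid : is_ideal C.
  split=> [|e e' [k Ek] [k' Ek']|a e [k Ek]].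
  - by exists 0; ring.
  - by exists (k + k'); rewrite mulrDl Ek Ek'; ring.
  - by exists (a * k); rewrite -mulrA Ek; ring.
have Cm : C m by exists n.
suff [k /[!mul1r] En] : C 1 by exists k.
apply: (nakayama Cid Cid Cm m_neq0) => e [k Ek].
have : (principal (m ^+ 2) `&` principal (n ^+ 2)) (n ^+ 2 * e).
  split; last by exists e.
  exists (k * x + e * y) => //; rewrite Enm.
  transitivity (x * (e * n) * m + e * y * m ^+ 2); last by ring.
  by rewrite Ek; ring.
rewrite star => mulJe.
(* As [mD] and [nD] meet in [n C], the square of their intersection is [n^2 C^2]; cancelling [n^2]
   leaves [e] in [C^2]. *)
have : [set n ^+ 2 * w | w in ideal_mul C C] (n ^+ 2 * e).
  move: mulJe; apply: smallest_sub.
    have [C0 addC mulC] := ideal_gen_ideal [set x * y | x in C & y in C].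
    split=> [|_ _ [w Cw <-] [w' Cw' <-]|a _ [w Cw <-]].
    - by exists 0; rewrite ?mulr0.
    - by exists (w + w'); [exact: addC|ring].
    - by exists (a * w); [exact: mulC|ring].
  move=> _ [_ [[k1 _ <-] [e1 _ E1]] [_ [[k2 _ <-] [e2 _ E2]] <-]].
  exists (e1 * e2); last by rewrite -E1 -E2; ring.
  by apply: ideal_mul_in; [exists k1|exists k2]; rewrite // mulrC.
by case=> w Cw /(mulfI (expf_neq0 2 n_neq0)) <-.
Qed.

Lemma quadratically_integrally_closed :
  quadratically_closed D -> integrally_closed D.
Proof.
move=> qclosed z [p p_monic /rootP pz0].
have [n [m [m_neq0 Ez]]] := frac_quotient z.
have Fm_neq0 : tofrac m != 0 by rewrite tofrac_eq0.
have En : tofrac n = tofrac m * z by rewrite Ez mulrCA divff ?mulr1.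
pose k := size p.
pose scaled (g : {poly D}) := tofrac (m ^+ k) * (map_poly (@tofrac D) g).[z].
(* Reduction modulo [p] keeps the value at [z] and leaves a degree below [k], so [m ^+ k] clears the
   denominators. *)
have scaled_in_D g : exists d : D, tofrac d = scaled g.
  pose r := rmodp g p.
  have -> : scaled g = scaled r.
    rewrite /scaled {1}(rdivp_eq p_monic g) rmorphD rmorphM hornerD hornerM.
    by rewrite pz0 mulr0 add0r.
  exists (\sum_(i < size r) r`_i * (n ^+ i * m ^+ (k - i))).
  rewrite /scaled horner_coef size_map_inj_poly ?rmorph0 //; last first.
    by move=> x y /eqP; rewrite tofrac_eq => /eqP.
  rewrite rmorph_sum mulr_sumr; apply: eq_bigr => i _.
  have le_ik : (i <= k)%N.
    apply: ltnW; apply: leq_trans (ltn_ord i) _; apply: ltnW.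
    by rewrite /k ltn_rmodp monic_neq0.
  rewrite coef_map /= !rmorphM !rmorphXn /= En exprMn.
  by rewrite -{2}(subnKC le_ik) exprD; ring.
(* [I = m^k D[z]], a nonzero ideal of [D] stable under [z = n / m]. *)
pose I : set D := [set d | exists g, tofrac d = scaled g].
have Iid : is_ideal I.
  split=> [|d e [g Ed] [h Ee]|a d [g Ed]].
  - by exists 0; rewrite /scaled !rmorph0 horner0 mulr0.
  - by exists (g + h); rewrite tofracD Ed Ee /scaled rmorphD hornerD mulrDr.
  - exists (a%:P * g); rewrite tofracM Ed /scaled rmorphM hornerM /=.
    by rewrite map_polyC hornerC mulrCA.
have Imk : I (m ^+ k) by exists 1; rewrite /scaled rmorph1 hornerC mulr1.
have stabI d : I d -> exists2 d', I d' & n * d = m * d'.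
  move=> [g Ed]; have [d' Ed'] := scaled_in_D ('X * g).
  exists d'; first by exists ('X * g).
  apply/eqP; rewrite -tofrac_eq !tofracM Ed Ed' En /scaled.
  by rewrite rmorphM hornerM /= map_polyX hornerX; apply/eqP; ring.
have mk_neq0 : m ^+ k != 0 by rewrite expf_neq0.
have [a [b /(qclosed _ _ _ _ m_neq0) [s Es]]] :=
  stabilizer_quadratic Iid Imk mk_neq0 stabI.
by exists s; apply: (mulfI Fm_neq0); rewrite -En Es tofracM.
Qed.

Lemma quadratically_closed_invertible :
  quadratically_closed D -> pairs_invertible D.
Proof.
move=> qclosed c d.
have [->|d_neq0] := eqVneq d 0; first by exists 0, 1, 0, 0; split; ring.
(* For [c] and [d] nonzero and [I = (c, d)], this is the product of [I] and its inverse fractional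
   ideal. *)
pose W : set D := [set w | exists x y s t : D,
  [/\ x + y = w, x * c = d * s & y * d = c * t]].
suff [x [y [s [t ?]]]] : W 1 by exists x, y, s, t.
have [W0 addW mulW] : is_ideal W.
  split=> [|_ _ [x [y [s [t [<- Ex Ey]]]]] [x' [y' [s' [t' [<- Ex' Ey']]]]]
          |a _ [x [y [s [t [<- Ex Ey]]]]]].
  - by exists 0, 0, 0, 0; split; ring.
  - exists (x + x'), (y + y'), (s + s'), (t + t').
    by rewrite !mulrDl !mulrDr Ex Ex' Ey Ey'; split=> //; ring.
  - exists (a * x), (a * y), (a * s), (a * t).
    by rewrite -!mulrA Ex Ey; split; ring.
(* Any relation between the generators of [I^2] has its coefficients in [W]; quadratic closure
   enters here. *)
have relW al be ga : al * c ^+ 2 + be * (c * d) + ga * d ^+ 2 = 0 ->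
    [/\ W al, W be & W ga].
  move=> rel.
  (* [al c / d] and [al c / d + be] are integral over [D]. *)
  have [|de Ede] := qclosed (- be) (- (al * ga)) (al * c) d d_neq0.
    apply/eqP; rewrite -subr_eq0 -[0](mulr0 al) -rel; apply/eqP; ring.
  have Ega : (de + be) * c = - ga * d.
    apply: (mulIf d_neq0); apply/eqP; rewrite -subr_eq0 -rel.
    apply/eqP; transitivity ((d * de) * c + be * (c * d) + ga * d ^+ 2).
      by ring.
    by rewrite -Ede; ring.
  split.
  - by exists al, 0, de, 0; split=> //; ring.
  - exists (de + be), (- de), (- ga), (- al); split; first by ring.
      by rewrite Ega mulrC.
    by rewrite mulNr [de * d]mulrC -Ede; ring.
  - exists 0, ga, 0, (- (de + be)); split; [ring|ring|].
    by rewrite mulrN [c * _]mulrC Ega; ring.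
pose S : set D := [set g | exists u v w,
  g = u * c ^+ 2 + v * (c * d) + w * d ^+ 2].
have Sid : is_ideal S.
  split=> [|_ _ [u [v [w ->]]] [u' [v' [w' ->]]]|a _ [u [v [w ->]]]].
  - by exists 0, 0, 0; ring.
  - by exists (u + u'), (v + v'), (w + w'); ring.
  - by exists (a * u), (a * v), (a * w); ring.
have [e [f ES]] := two_gen Sid.
have [r1 [r2 [r3 Ee]]] : S e by rewrite ES; apply/ideal_gen2P; exists 1, 0; ring.
have [s1 [s2 [s3 Ef]]] : S f by rewrite ES; apply/ideal_gen2P; exists 0, 1; ring.
have [p1 [q1 E1]] : exists u v, c ^+ 2 = u * e + v * f.
  by apply/ideal_gen2P; rewrite -ES; exists 1, 0, 0; ring.
have [p2 [q2 E2]] : exists u v, c * d = u * e + v * f.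
  by apply/ideal_gen2P; rewrite -ES; exists 0, 1, 0; ring.
have [p3 [q3 E3]] : exists u v, d ^+ 2 = u * e + v * f.
  by apply/ideal_gen2P; rewrite -ES; exists 0, 0, 1; ring.
(* Passing from [g] to [e], [f] and back to [c^2], [cd], [d^2] gives a second expression of [g]; the
   difference of the two is a relation. *)
have rowW g p q u v w : g = u * c ^+ 2 + v * (c * d) + w * d ^+ 2 ->
    g = p * e + q * f ->
    [/\ W (p * r1 + q * s1 - u), W (p * r2 + q * s2 - v)
      & W (p * r3 + q * s3 - w)].
  move=> Eg Eg'; apply: relW.
  transitivity (p * (r1 * c ^+ 2 + r2 * (c * d) + r3 * d ^+ 2) +
                q * (s1 * c ^+ 2 + s2 * (c * d) + s3 * d ^+ 2) -
                (u * c ^+ 2 + v * (c * d) + w * d ^+ 2)); first by ring.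
  by rewrite -Ee -Ef -Eg -Eg' subrr.
(* Entries on and above the diagonal suffice: below, [1 - \det M] telescopes as the rows of [M] are
   replaced from the top by those of the identity. *)
have [|W11 W12 W13] := rowW _ p1 q1 1 0 0 _ E1; first by ring.
have [|_ W22 W23] := rowW _ p2 q2 0 1 0 _ E2; first by ring.
have [|_ _ W33] := rowW _ p3 q3 0 0 1 _ E3; first by ring.
(* The 3x3 matrix [M i j = p_i r_j + q_i s_j] has rank at most 2, so that
   [\det M = 0], while [M - 1] has its entries in [W]. *)
pose M21 := p2 * r1 + q2 * s1; pose M22 := p2 * r2 + q2 * s2.
pose M23 := p2 * r3 + q2 * s3; pose M31 := p3 * r1 + q3 * s1.
pose M32 := p3 * r2 + q3 * s2; pose M33 := p3 * r3 + q3 * s3.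
have -> : 1 = - (M22 * M33 - M23 * M32) * (p1 * r1 + q1 * s1 - 1) +
    ((M21 * M33 - M23 * M31) * (p1 * r2 + q1 * s2 - 0) +
     (- (M21 * M32 - M22 * M31) * (p1 * r3 + q1 * s3 - 0) +
      (- M33 * (p2 * r2 + q2 * s2 - 1) +
       (M32 * (p2 * r3 + q2 * s3 - 0) +
        - 1 * (p3 * r3 + q3 * s3 - 1))))).
  by rewrite /M21 /M22 /M23 /M31 /M32 /M33; ring.
by do 5![apply: (addW); first exact: mulW]; apply: mulW.
Qed.

End Ideals.

(** * Consequences of invertibility *)

Lemma pairs_invertible_star (D : idomainType) :
  pairs_invertible D -> star_domain D.
Proof.
move=> inv a b; apply/seteqP; split=> [z [[al _ Ea] [be _ Eb]]|]; last first.
  apply: smallest_sub; first by apply: setI_ideal; apply: principal_ideal.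
  move=> _ [_ [[u _ <-] [v _ Ev]] [_ [[u' _ <-] [v' _ Ev']] <-]].
  split; first by exists (u * u') => //; ring.
  by exists (v * v') => //; rewrite -Ev -Ev'; ring.
have [x [y [s [t [Exy Ex Ey]]]]] := inv b a.
have Jx : (principal a `&` principal b) (x * b).
  by split; [exists s|exists x; rewrite // mulrC].
have Jy : (principal a `&` principal b) (y * a).
  by split; [exists y; rewrite // mulrC|exists t].
have -> : z = (be * (x + 3 * y)) * ((x * b) * (x * b)) +
              (al * (3 * x + y)) * ((y * a) * (y * a)).
  (* Every monomial of the cube contains [x^2] or [y^2], and [z x^2 = be (x b)^2],
     [z y^2 = al (y a)^2]. *)
  transitivity (z * (x + y) ^+ 3); first by rewrite Exy; ring.
  transitivity (z * x ^+ 2 * (x + 3 * y) + z * y ^+ 2 * (3 * x + y)).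
    by ring.
  by rewrite -{1}Eb -Ea; ring.
have [_ addI mulI] := ideal_gen_ideal
  [set x * y | x in principal a `&` principal b
             & y in principal a `&` principal b].
by apply: addI; apply: mulI; apply: ideal_mul_in.
Qed.

(** If [J] strictly contains [P], invertibility of the pairs [(p, c)] with [c] in [J] outside [P]
    gives [P = J P], and Nakayama yields [J = D]. *)
Lemma prime_maximal (D : idomainType) (P : set D) :
  ideals_two_generated D -> pairs_invertible D ->
  prime_ideal P -> P <> [set 0] -> maximal_ideal P.
Proof.
move=> two_gen inv [Pid PT primeP] P_neq0; split=> // J Jid PJ.
have [JP|/existsNP [c /not_implyP [Jc nPc]]] := pselect (J `<=` P).
  by left; apply/seteqP.
have [P0 addP mulP] := Pid; have [J0 addJ mulJ] := Jid.
have [p [Pp p_neq0]] : exists p, P p /\ p != 0.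
  apply: contrapT => noP; apply: P_neq0; apply/seteqP; split=> [p Pp|_ -> //].
  by apply/eqP/negPn/negP => p_neq0; apply: noP; exists p.
right; apply: ideal_one => //; apply: (nakayama two_gen Pid Jid Pp p_neq0).
(* [P `<=` J P], as every [p] in [P] lies in [(c, p) P]. *)
move=> {Pp p_neq0} p Pp.
have [x [y [s [t [Exy Ex Ey]]]]] := inv p c.
(* Both [c s = x p] and [y c = p t] lie in [P] while [c] does not, so primality puts [s] and [y] in
   [P]. *)
have Ps : P s.
  have /primeP [//|//] : P (c * s) by rewrite -Ex; apply: mulP.
have Py : P y.
  have /primeP [//|//] : P (y * c) by rewrite Ey mulrC; apply: mulP.
have -> : p = c * s + y * p by rewrite -Ex -mulrDl Exy mul1r.
have [_ addI _] := ideal_gen_ideal [set x * y | x in J & y in P].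
by apply: addI; apply: ideal_mul_in => //; apply: PJ.
Qed.

Theorem corollary2p7 (D : idomainType) (h2 : ideals_two_generated D) :
  star_domain D <-> dedekind_domain D.
Proof.
split=> [star|[_ iclosed _]]; last first.
  apply: pairs_invertible_star; apply: quadratically_closed_invertible => //.
  exact: integrally_quadratically_closed.
have qclosed := star_quadratically_closed h2 star.
split.
- move=> I /h2 [a [b ->]]; exists [:: a; b]; congr ideal_gen.
  apply/seteqP; split=> x /=; rewrite !inE.
    by case=> ->; rewrite eqxx ?orbT.
  by case/orP=> /eqP ->; [left|right].
- exact: quadratically_integrally_closed.
- move=> P; apply: prime_maximal => //.
  exact: quadratically_closed_invertible.
Qed.
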